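(* Let $m,n\geq 1$ be integers, let $A\in\mathbb{R}^{m\times n}$, and let $\epsilon=(\epsilon_1,\ldots,\epsilon_{\min\{m,n\}})$ with each $\epsilon_r\in\{1,-1\}$; set $\epsilon_0:=1$. For every square submatrix $A_k$ of $A$ (of size $k\times k$, $1\leq k\leq\min\{m,n\}$), let an arbitrary vector $\boldsymbol{\alpha}=(\alpha_1,-\alpha_2,\ldots,(-1)^{k-1}\alpha_k)^T\in\mathbb{R}^k$ with all $\alpha_j>0$ be fixed, and define $\mathbf{y}^{A_k}:=\mathrm{adj}(A_k)\boldsymbol{\alpha}\in\mathbb{R}^k$. Then the following statements are equivalent. (1) $A$ is SR$(\epsilon)$. (2) For all $\mathbf{x}\in\mathbb{R}^n$, we have $S^-(A\mathbf{x})\leq S^-(\mathbf{x})$. Moreover, for all $\mathbf{x}\in\mathbb{R}^n$ with $A\mathbf{x}\neq\mathbf{0}$ and $S^-(A\mathbf{x})=S^-(\mathbf{x})=r$, if $0\leq r\leq\min\{m,n\}-1$, then the sign of the first (respectively last) non-zero component of $A\mathbf{x}$ agrees with $\epsilon_r\epsilon_{r+1}$ times the sign of the first (respectively last) non-zero component of $\mathbf{x}$. (3) For every $1\leq k\leq\min\{m,n\}$ and every $k\times k$ submatrix $A_k$ of $A$, we have $S^-(A_k\mathbf{y}^{A_k})\leq S^-(\mathbf{y}^{A_k})$. Moreover, if $S^-(A_k\mathbf{y}^{A_k})=S^-(\mathbf{y}^{A_k})=r$, and if $0\leq r\leq k-1$ and $A_k\mathbf{y}^{A_k}\neq\mathbf{0}$,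 then the sign of the first (respectively last) non-zero component of $A_k\mathbf{y}^{A_k}$ agrees with $\epsilon_r\epsilon_{r+1}$ times the sign of the first (respectively last) non-zero component of $\mathbf{y}^{A_k}$.
   Context: Sign changes: for $\mathbf{x}=(x_1,\ldots,x_n)^T\in\mathbb{R}^n$, $S^-(\mathbf{x})$ is the number of sign changes in the sequence $x_1,\ldots,x_n$ after discarding all zero entries, with $S^-(\mathbf{0}):=0$. SR$(\epsilon)$: a real $m\times n$ matrix $A$ is SR$(\epsilon)$ (sign regular with sign pattern $\epsilon=(\epsilon_1,\ldots,\epsilon_{\min\{m,n\}})$) if for each $1\leq r\leq\min\{m,n\}$ every non-zero $r\times r$ minor of $A$ has sign $\epsilon_r$ (minors are allowed to vanish). A $k\times k$ submatrix of $A$ is given by arbitrary rows $i_1<\cdots<i_k$ and columns $j_1<\cdots<j_k$ (not necessarily consecutive). $\mathrm{adj}(A_k)$ denotes the adjugate matrix of $A_k$ (transpose of the cofactor matrix); for $k=1$, $\mathrm{adj}(A_1):=1$. *)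

(* Defs.v *)
From mathcomp Require Import all_boot all_order all_algebra.
From mathcomp Require Import reals.

Set Implicit Arguments.
Unset Strict Implicit.
Unset Printing Implicit Defensive.

Import Order.TTheory GRing.Theory Num.Theory.

Local Open Scope ring_scope.

Section SignRegular.
Variable R : realType.

Definition nonzero_entries n (x : 'cV[R]_n) : seq R :=
  [seq a <- [seq x i 0 | i <- enum 'I_n] | a != 0].

(* S^-(x): adjacent pairs of opposite signs, zeros being discarded first;
   the value at 0 is 0. *)
Definition sign_changes n (x : 'cV[R]_n) : nat :=
  let s := nonzero_entries x in
  count (fun p : R * R => p.1 * p.2 < 0) (zip s (behead s)).

(* The default value 0 is only reached when x = 0. *)
Definition first_nonzero n (x : 'cV[R]_n) : R := head 0 (nonzero_entries x).
Definition last_nonzero n (x : 'cV[R]_n) : R := last 0 (nonzero_entries x).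

(* Index selections i_1 < ... < i_k: a k x k submatrix of A is
   [mxsub f g A] with f and g strictly increasing. *)
Definition increasing k n (f : 'I_k -> 'I_n) : Prop :=
  forall i j : 'I_k, (i < j)%N -> (f i < f j)%N.

(* Patterns eps = (eps_1, ..., eps_d), extended by eps_0 = 1; the values
   beyond d are irrelevant. *)
Definition sign_pattern (d : nat) (eps : nat -> R) : Prop :=
  eps 0%N = 1 /\ forall r : nat, (1 <= r <= d)%N -> eps r = 1 \/ eps r = -1.

Definition sign_regular (eps : nat -> R) m n (A : 'M[R]_(m, n)) : Prop :=
  forall (r : nat) (f : 'I_r -> 'I_m) (g : 'I_r -> 'I_n),
    (1 <= r <= minn m n)%N -> increasing f -> increasing g ->
    \det (mxsub f g A) != 0 -> Num.sg (\det (mxsub f g A)) = eps r.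

Definition variation_diminishing_at (eps : nat -> R) m n
    (A : 'M[R]_(m, n)) (x : 'cV[R]_n) : Prop :=
  (sign_changes (A *m x) <= sign_changes x)%N /\
  forall r : nat,
    A *m x != 0 -> sign_changes (A *m x) = r -> sign_changes x = r ->
    (0 <= r <= minn m n - 1)%N ->
    Num.sg (first_nonzero (A *m x))
      = eps r * eps r.+1 * Num.sg (first_nonzero x) /\
    Num.sg (last_nonzero (A *m x))
      = eps r * eps r.+1 * Num.sg (last_nonzero x).

(* (a_1, -a_2, ..., (-1)^(k-1) a_k)^T, indexed from 0. *)
Definition alternating_vector k (a : 'I_k -> R) : 'cV[R]_k :=
  \col_j ((-1) ^+ j * a j).

(* For k = 1, [\adj B] is the identity, since the empty determinant is 1. *)
Definition test_vector k (B : 'M[R]_k) (a : 'I_k -> R) : 'cV[R]_k :=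
  \adj B *m alternating_vector a.

End SignRegular.

(* Main.v *)
(* (1) => (2): group the columns of A according to the p + 1 sign blocks of x,
   weighted by |x_j|, to get B with A x = B z and z alternating.  The minors of
   B are nonnegative combinations of minors of A, so B has the same signs.  If
   q + 1 rows of w = B z alternate in sign, they are linearly independent:
   otherwise take a minimal failure, bring in q independent columns C of these
   rows, and expand the vanishing determinant of [w | C] along w; all terms
   have the same sign and one is nonzero.  Hence q <= p, and when q = p
   Cramer's rule for z_0 yields the sign eps_p eps_(p+1).
   (3) => (1): by induction on the order, since A_k y = det(A_k) alpha and the
   first entry of y is a positive combination of minors of order k - 1. *)
Require Import Defs.
From mathcomp Require Import all_boot all_order all_fingroup all_algebra.
From mathcomp Require Import reals ring lra zify.

Set Implicit Arguments.
Unset Strict Implicit.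
Unset Printing Implicit Defensive.

Import Order.TTheory GRing.Theory Num.Theory.

Local Open Scope ring_scope.

(** * Sign changes of sequences *)

Definition changes {R : realType} (u : seq R) : nat :=
  count (fun p : R * R => p.1 * p.2 < 0) (zip u (behead u)).

Lemma sgr_next (R : realType) (a b : R) :
  a != 0 -> b != 0 -> Num.sg b = (-1) ^+ (a * b < 0)%R * Num.sg a.
Proof.
move=> a0 b0; case: (ltrgt0P a) a0 => // ha _; case: (ltrgt0P b) b0 => // hb _.
- by rewrite ltNge (ltW (mulr_gt0 ha hb)) !gtr0_sg // mul1r.
- by rewrite pmulr_rlt0 // hb ltr0_sg // gtr0_sg // mulr1.
- by rewrite nmulr_rlt0 // hb gtr0_sg // ltr0_sg //= expr1 mulrNN mulr1.
- by rewrite nmulr_rlt0 // ltNge (ltW hb) !ltr0_sg // mul1r.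
Qed.

Lemma sgr_last_changes (R : realType) (a : R) (u : seq R) :
  all (fun b => b != 0) (a :: u) ->
  Num.sg (last a u) = (-1) ^+ changes (a :: u) * Num.sg a.
Proof.
elim: u a => [|b u IHu] a; first by rewrite mul1r.
case/andP=> a0 hu; have /andP[b0 _] := hu.
rewrite [last _ _]/= IHu // (@sgr_next _ a b) // mulrA -exprD addnC.
by [].
Qed.

Lemma leq_changes_cat (R : realType) (u v : seq R) :
  (changes u <= changes (u ++ v))%N.
Proof.
elim: u => [|a [|b u] IHu] //.
by have := leq_add2l (a * b < 0)%R (changes (b :: u)) (changes (b :: u ++ v));
   rewrite IHu.
Qed.

(** The last entry of each run of constant sign is selected: [a] is put in front only when its
    successor has the opposite sign. *)
Lemma alternating_subseq (R : realType) (a : R) (u : seq R) :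
  all (fun b => b != 0) (a :: u) ->
  exists v, [/\ subseq v (a :: u), size v = (changes (a :: u)).+1 &
    forall i, (i < size v)%N -> Num.sg v`_i = (-1) ^+ i * Num.sg a].
Proof.
elim: u a => [|b u IHu] a.
  by move=> _; exists [:: a]; split=> //=; rewrite ?eqxx // => -[] //; rewrite mul1r.
case/andP=> a0 hu; have /andP[b0 _] := hu; have [v [vu sv Hv]] := IHu b hu.
have sab := sgr_next a0 b0.
have ec : changes [:: a, b & u] = ((a * b < 0)%R + changes (b :: u))%N by [].
case ab: (a * b < 0); rewrite ab /= in sab ec.
  exists (a :: v); split; first by rewrite /= eqxx.
    by rewrite /= sv ec.
  case=> [|i] Hi; first by rewrite mul1r.
  by rewrite [LHS]/= Hv // sab mulrA -exprSr.
exists v; split; first exact: (subseq_trans vu (subseq_cons _ _)).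
  by rewrite sv ec.
by move=> i Hi; rewrite Hv // sab mul1r.
Qed.

(** * Alternating selections and sign blocks of a vector *)

Definition entries {R : realType} {n} (x : 'cV[R]_n) : seq R :=
  [seq x i 0 | i <- enum 'I_n].

Lemma size_entries (R : realType) n (x : 'cV[R]_n) : size (entries x) = n.
Proof. by rewrite size_map size_enum_ord. Qed.

Lemma nth_entries (R : realType) n (x : 'cV[R]_n) (i : 'I_n) :
  (entries x)`_i = x i 0.
Proof.
have i0 := i.
by rewrite (nth_map i0) ?size_enum_ord // nth_ord_enum.
Qed.

Lemma nonzero_entries_neq0 (R : realType) n (x : 'cV[R]_n) :
  x != 0 -> nonzero_entries x != [::].
Proof.
apply: contraNneq => hx; apply/eqP/colP => i; rewrite mxE.
have : x i 0 \notin nonzero_entries x by rewrite hx.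
rewrite mem_filter negb_and negbK => /orP[/eqP //|/negP[]].
by apply: (map_f (fun i => x i 0)); rewrite mem_enum.
Qed.

(** A witness for at least [q] sign changes. Only the sign of [s] matters, so [s] may be a sign or a
    determinant. *)
Definition alternates {R : realType} {n} (q : nat) (s : R) (x : 'cV[R]_n) :=
  exists2 f : 'I_q.+1 -> 'I_n, increasing f &
    forall i : 'I_q.+1, 0 < s * (-1) ^+ i * x (f i) 0.

Lemma alternates_first (R : realType) n (x : 'cV[R]_n) :
  x != 0 -> alternates (sign_changes x) (Num.sg (first_nonzero x)) x.
Proof.
move=> /nonzero_entries_neq0.
have : all (fun b => b != 0) (nonzero_entries x) by apply: filter_all.
rewrite /alternates /sign_changes -/(changes _) /first_nonzero.
have : subseq (nonzero_entries x) (entries x) by apply: filter_subseq.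
case: (nonzero_entries x) => // a u au_x nz _.
have [v [vu sv Hv]] := alternating_subseq nz.
(* The mask that cuts [v] out of the entries is applied to the list of indices, which yields the
   increasing selection. *)
have /subseqP[m sm] := subseq_trans vu au_x.
rewrite -map_mask; set l := mask m _ => vE.
have lS : sorted ltn (map val l).
  rewrite (subseq_sorted ltn_trans _ (iota_ltn_sorted 0 n)) //.
  by rewrite -val_enum_ord map_subseq // mask_subseq.
have sl : size l = (changes (a :: u)).+1 by rewrite -sv vE size_map.
case: l vE lS sl => [|i0 l0] // vE lS sl; set l := i0 :: l0 in vE lS sl.
exists (fun i => nth i0 l i) => [i j ij|i].
  have := sorted_ltn_nth ltn_trans 0%N lS.
  move=> /(_ i j); rewrite !inE !size_map sl !ltn_ord => /(_ isT isT ij).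
  by rewrite !(nth_map i0) ?sl.
have hv : Num.sg v`_i = (-1) ^+ i * Num.sg a by rewrite Hv // sv.
have ex : v`_i = x (nth i0 l i) 0 by rewrite vE (nth_map i0) // sl.
have a0 : a != 0 by case/andP: nz.
rewrite -ex -sgr_gt0 2!sgrM hv sgrX sgrN1 sgr_id [head _ _]/=.
rewrite [ltRHS](_ : _ = ((-1) ^+ i) ^+ 2 * Num.sg a ^+ 2); last by ring.
by rewrite sqrr_sign mul1r sqr_sg a0.
Qed.

(* Number (from 0) of the constant-sign run of x containing the entry i. *)
Definition block {R : realType} {n} (x : 'cV[R]_n) (i : nat) : nat :=
  changes [seq a <- take i.+1 (entries x) | a != 0].

Lemma block_le (R : realType) n (x : 'cV[R]_n) i j :
  (i <= j)%N -> (block x i <= block x j)%N.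
Proof.
move=> ij; rewrite /block -(@take_takel _ i.+1 j.+1) //.
rewrite -[in leqRHS](cat_take_drop i.+1 (take j.+1 _)) filter_cat.
exact: leq_changes_cat.
Qed.

Lemma block_sign_changes (R : realType) n (x : 'cV[R]_n) i :
  (block x i <= sign_changes x)%N.
Proof.
rewrite /sign_changes -/(changes _) /nonzero_entries -/(entries x).
by rewrite -(cat_take_drop i.+1 (entries x)) filter_cat leq_changes_cat.
Qed.

(** Once zeros are dropped, the prefix ending at a non-zero [x i 0] runs from the first non-zero
    entry to this one. *)
Lemma sgr_block (R : realType) n (x : 'cV[R]_n) (i : 'I_n) : x i 0 != 0 ->
  Num.sg (x i 0) = (-1) ^+ block x i * Num.sg (first_nonzero x).
Proof.
move=> xi0; set u := [seq a <- take i.+1 (entries x) | a != 0].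
have uE : u = rcons [seq a <- take i (entries x) | a != 0] (x i 0).
  by rewrite /u (take_nth 0) ?size_entries // filter_rcons nth_entries xi0.
have -> : first_nonzero x = head 0 u.
  rewrite /first_nonzero /nonzero_entries -/(entries x).
  rewrite -{1}(cat_take_drop i.+1 (entries x)) filter_cat -/u uE.
  by case: filter.
have ul : last 0 u = x i 0 by rewrite uE last_rcons.
have nz : all (fun a => a != 0) u by apply: filter_all.
have : u != [::] by rewrite uE; case: filter.
rewrite /block -/u -ul; case: u nz {uE ul} => // a u nz _.
exact: (@sgr_last_changes R a u nz).
Qed.

(** This reduces each claim on last non-zero components to the claim on first ones, since the two
    vectors compared there have equally many sign changes. *)
Lemma sgr_last_nonzero (R : realType) n (x : 'cV[R]_n) :
  Num.sg (last_nonzero x) = (-1) ^+ sign_changes x * Num.sg (first_nonzero x).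
Proof.
have : all (fun b => b != 0) (nonzero_entries x) by apply: filter_all.
rewrite /last_nonzero /first_nonzero /sign_changes -/(changes _).
case: nonzero_entries => [_|a u nz]; first by rewrite sgr0 mulr0.
exact: (@sgr_last_changes R a u nz).
Qed.

(* Block indices along an alternating selection change parity at each step, so
   they increase strictly. *)
Lemma alternates_le (R : realType) n (x : 'cV[R]_n) q (s : R) :
  alternates q s x -> (q <= sign_changes x)%N /\
  (q = sign_changes x -> Num.sg s = Num.sg (first_nonzero x)).
Proof.
case=> f f_incr Hf.
have xf0 i : x (f i) 0 != 0.
  by apply: contraTneq (Hf i) => ->; rewrite mulr0 ltxx.
have fx0 : Num.sg (first_nonzero x) != 0.
  have : Num.sg (x (f ord0) 0) != 0 by rewrite sgr_eq0.
  rewrite sgr_block //.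
  by apply: contraNneq => ->; rewrite mulr0.
have par (i : 'I_q.+1) : Num.sg (s * first_nonzero x) = (-1) ^+ (i + block x (f i)).
  move: (Hf i); rewrite -sgr_gt0 2!sgrM sgrX sgrN1 sgr_block //.
  rewrite mulrCA [X in _ * X]mulrAC -sgrM [X in _ * X]mulrC mulrA -exprD addnC.
  rewrite -signr_odd; case: odd; case: sgrP => //;
    by rewrite ?(expr1, expr0, mulN1r, mul1r, opprK, oppr0, ltxx, oppr_gt0, ltr10).
have ge (i : 'I_q.+1) : (i + block x (f ord0) <= block x (f i))%N.
  case: i; elim=> [|i IHi] hi; first by rewrite (_ : Ordinal hi = ord0) //; apply: val_inj.
  have hi' := ltnW hi; have := IHi hi'.
  have : (block x (f (Ordinal hi')) <= block x (f (Ordinal hi)))%N.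
    by rewrite block_le // ltnW // f_incr.
  have := par (Ordinal hi); rewrite (par (Ordinal hi')) /= => /eqP.
  rewrite -signr_odd -[eqbRHS]signr_odd (inj_eq signr_inj).
  rewrite !oddD /= => e b1 b2.
  rewrite addSn ltn_neqAle (leq_trans b2) // andbT.
  apply: contraTneq e => e; have : block x (f (Ordinal hi')) = block x (f (Ordinal hi)).
    by apply/eqP; rewrite eqn_leq b1 -e b2.
  by move=> ->; case: odd; case: odd.
have := ge ord_max; have := block_sign_changes x (f ord_max) => /= h1 h2.
split; first lia.
(* With equality the selection must start in block 0, which carries the sign of the first non-zero
   entry. *)
move=> qS; have b0 : block x (f ord0) = 0%N by lia.
have := par ord0; rewrite b0 sgrM expr0 => e1.
have f2 : Num.sg (first_nonzero x) * Num.sg (first_nonzero x) = 1.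
  by rewrite -expr2 sqr_sg -sgr_eq0 fx0.
by rewrite -[LHS]mulr1 -f2 mulrA e1 mul1r.
Qed.

(** * Increasing selections, minors and cofactors *)

Lemma increasing_comp k m n (f : 'I_m -> 'I_n) (g : 'I_k -> 'I_m) :
  increasing f -> increasing g -> increasing (f \o g).
Proof. by move=> hf hg i j /hg /hf. Qed.

Lemma increasing_lift n (i : 'I_n.+1) : increasing (lift i).
Proof. by move=> j k; rewrite /= !ltnNge leq_bump2. Qed.

Lemma increasing_inj k n (f : 'I_k -> 'I_n) : increasing f -> injective f.
Proof.
move=> hf i j eqf; apply: val_inj; case: (ltngtP i j) => // /hf.
  by rewrite eqf ltnn.
by rewrite eqf ltnn.
Qed.

Lemma increasing_leq k n (f : 'I_k -> 'I_n) : increasing f -> (k <= n)%N.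
Proof. by move=> /increasing_inj /leq_card; rewrite !card_ord. Qed.

Lemma increasing_first n (f : 'I_n.+1 -> 'I_n.+1) :
  increasing f -> f ord0 = ord0.
Proof.
move=> hf; have f_inj := increasing_inj hf.
have [e|fi0] := eqVneq ord0 (invF f_inj ord0); first by rewrite [in LHS]e f_invF.
have /(hf ord0) : (0 < invF f_inj ord0)%N.
  by rewrite lt0n; apply/negP => /eqP e; case/eqP: fi0; apply: val_inj.
by rewrite f_invF.
Qed.

(** Cauchy-Binet before grouping by image: distributing the products of sums gives one term for each
    map [h], increasing or not. *)
Lemma det_mul_colsub (R : comPzRingType) r n (A : 'M[R]_(r, n)) (P : 'M[R]_(n, r)) :
  \det (A *m P) =
  \sum_(h : {ffun 'I_r -> 'I_n}) (\prod_i P (h i) i) * \det (colsub h A).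
Proof.
rewrite -det_tr trmx_mul.
transitivity (\sum_(h : {ffun 'I_r -> 'I_n}) \sum_(s : 'S_r)
    (-1) ^+ s * \prod_i (P (h i) i * A (s i) (h i))).
  rewrite exchange_big; apply: eq_bigr => s _; rewrite -big_distrr /=.
  congr (_ * _); rewrite -(bigA_distr_bigA (fun i j => P j i * A (s i) j)).
  by apply: eq_bigr => i _; rewrite mxE; apply: eq_bigr => j _; rewrite !mxE.
apply: eq_bigr => h _; rewrite -det_tr big_distrr; apply: eq_bigr => s _.
rewrite big_split mulrCA /=; congr (_ * (_ * _)).
by apply: eq_bigr => i _; rewrite !mxE.
Qed.

(* If B P = 1, expanding det (B P) over the columns of B gives a nonzero minor;
   its columns are then sorted. *)
Lemma row_free_minor (F : fieldType) q n (B : 'M[F]_(q, n)) : row_free B ->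
  exists2 g : 'I_q -> 'I_n, increasing g & \det (colsub g B) != 0.
Proof.
case/row_freeP => P BP.
have [h detB] : exists h : {ffun 'I_q -> 'I_n}, \det (colsub h B) != 0.
  apply/existsP; apply: contraT; rewrite negb_exists => /forallP h0.
  have /eqP := det1 F q; rewrite -BP det_mul_colsub big1 => [|h _].
    by rewrite eq_sym oner_eq0.
  by have /negPn/eqP -> := h0 h; rewrite mulr0.
have h_inj : injective h.
  move=> i j hij; apply/eqP; apply: contraNT detB => ij.
  by rewrite -det_tr (determinant_alternate ij) // => k; rewrite !mxE hij.
pose t := [tuple h i | i < q].
pose le (i j : 'I_n) := (i <= j)%N.
have /tuple_permP[p pE] : perm_eq (sort le t) t by rewrite perm_sort.
exists (h \o p) => [i j ij|].
  have : sorted leq (map val (sort le t)).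
    by rewrite sorted_map sort_sorted // => a b; apply: leq_total.
  move=> /(sorted_leq_nth leq_trans leqnn 0%N) /(_ i j).
  rewrite !inE !size_map size_sort size_tuple !ltn_ord => /(_ isT isT (ltnW ij)).
  rewrite !(nth_map (h i)) ?size_sort ?size_tuple // pE.
  rewrite -!tnth_nth !tnth_mktuple /= leq_eqVlt => /orP[/eqP/val_inj/h_inj/perm_inj e|//].
  by rewrite e ltnn in ij.
have -> : colsub (h \o p) B = col_perm p (colsub h B).
  by apply/matrixP => i j; rewrite !mxE.
by rewrite col_permE det_mulmx det_perm mulf_neq0 // signr_eq0.
Qed.

Lemma cofactor_col0 (R : pzRingType) q (D : 'M[R]_q.+1) (i : 'I_q.+1) :
  cofactor D i ord0 = (-1) ^+ i * \det (mxsub (lift i) (lift ord0) D).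
Proof.
rewrite /cofactor addn0; congr (_ * \det _).
by apply/matrixP => j k; rewrite !mxE.
Qed.

(** This is Cramer's numerator for the first unknown. For an alternating [v] the signs [(-1) ^+ i]
    cancel, leaving a sum of minors with weights of one sign. *)
Lemma adj_mul_first (R : comPzRingType) q (D : 'M[R]_q.+1) (v : 'cV[R]_q.+1) :
  (\adj D *m v) ord0 0 =
  \sum_(i < q.+1) (-1) ^+ i * v i 0 * \det (mxsub (lift i) (lift ord0) D).
Proof.
by rewrite mxE; apply: eq_bigr => i _; rewrite mxE cofactor_col0 mulrAC.
Qed.

(** * Linear independence of rows with alternating images *)

Lemma row_free_alternating_step (R : realType) q n (B : 'M[R]_(q.+1, n))
    (x : 'cV[R]_n) (s : R) :
  (forall (f f' : 'I_q -> 'I_q.+1) (g : 'I_q -> 'I_n),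
     increasing f -> increasing f' -> increasing g ->
     0 <= \det (mxsub f g B) * \det (mxsub f' g B)) ->
  (forall i : 'I_q.+1, 0 < s * (-1) ^+ i * (B *m x) i 0) ->
  row_free (rowsub (lift ord_max) B) -> row_free B.
Proof.
move=> Bsign Bx /row_free_minor[g g_incr].
have -> : colsub g (rowsub (lift ord_max) B) = mxsub (lift ord_max) g B.
  by apply/matrixP => i j; rewrite !mxE.
set M := \det _ => M0; apply: contraT => Bnf.
(* This is the matrix [w | C], with w the image of [x] and C the columns [g] of [B]. Being a product
   with left factor [B], it is singular when the rows of [B] are dependent. *)
pose D : 'M_q.+1 := B *m row_mx x (colsub g 1%:M).
have Dw i : D i ord0 = (B *m x) i 0.
  rewrite /D mul_mx_row (_ : ord0 = lshift q 0 :> 'I_(1 + q)); last exact: val_inj.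
  exact: row_mxEl.
have Dg i j : D i (lift ord0 j) = B i (g j).
  rewrite /D mul_mx_row (_ : lift ord0 j = rshift 1 j :> 'I_(1 + q)); last exact: val_inj.
  by rewrite mulmx_colsub mulmx1; apply: etrans (row_mxEr _ _ _ _) _; rewrite mxE.
have /eqP : \det D = 0.
  apply/eqP; apply: contraNT Bnf => D0.
  rewrite -row_leq_rank.
  have Du : D \in unitmx by rewrite unitmxE unitfE.
  by rewrite -[X in (X <= _)%N](mxrank_unit Du) mxrankM_maxl.
rewrite (expand_det_col D ord0) => /eqP sum0.
have DM i : mxsub (lift i) (lift ord0) D = mxsub (lift i) g B.
  by apply/matrixP => j k; rewrite [LHS]mxE [RHS]mxE Dg.
(* The factor [s] makes the signed entries of w positive and [M] fixes the common sign of the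
   minors, so no term is negative. *)
have term i : 0 <= D i ord0 * cofactor D i ord0 * (s * M).
  rewrite cofactor_col0 Dw DM.
  rewrite [leRHS](_ : _ = s * (-1) ^+ i * (B *m x) i 0 *
    (\det (mxsub (lift i) g B) * M)); last by ring.
  by rewrite mulr_ge0 ?(ltW (Bx i)) // Bsign //; apply: increasing_lift.
have := congr1 (fun a => a * (s * M)) sum0; rewrite mul0r mulr_suml => /eqP.
(* Deleting the last row gives the minor [M] itself, so this term is a positive number times [M * M]
   and cannot vanish. *)
rewrite psumr_eq0 // => /allP /(_ ord_max); rewrite mem_index_enum => /(_ isT) /=.
rewrite cofactor_col0 Dw DM -/M => /eqP e; have := mulr_gt0 (Bx ord_max) (_ : 0 < M * M).
rewrite -expr2 exprn_even_gt0 // M0 => /(_ isT).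
rewrite [ltRHS](_ : _ = (B *m x) ord_max 0 * ((-1) ^+ @ord_max q * M) * (s * M)); last by ring.
by rewrite e ltxx.
Qed.

(** Both hypotheses survive the removal of the last row, so the step climbs from the empty family of
    rows, which is free. *)
Lemma row_free_alternating (R : realType) q n (B : 'M[R]_(q.+1, n))
    (x : 'cV[R]_n) (s : R) :
  (forall r (f f' : 'I_r -> 'I_q.+1) (g : 'I_r -> 'I_n),
     increasing f -> increasing f' -> increasing g ->
     0 <= \det (mxsub f g B) * \det (mxsub f' g B)) ->
  (forall i : 'I_q.+1, 0 < s * (-1) ^+ i * (B *m x) i 0) -> row_free B.
Proof.
elim: q B => [|q IHq] B Bsign Bx; apply: (row_free_alternating_step (Bsign _) Bx).
  by rewrite /row_free -leqn0 rank_leq_row.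
apply: IHq => [r f f' g hf hf' hg|i].
  rewrite -!mxsub_comp /=.
  by apply: Bsign => //; apply: increasing_comp => //; apply: increasing_lift.
by rewrite mul_rowsub_mx mxE; have := Bx (lift ord_max i); rewrite lift_max.
Qed.

(** * Signs of minors under merging and alternation *)

(** Weak inequalities pass to non-negative combinations of minors. Order 0 is included so that an
    induction on the order can start there. *)
Definition minors_sign {R : realType} (eps : nat -> R) m n (A : 'M[R]_(m, n)) :=
  forall r (f : 'I_r -> 'I_m) (g : 'I_r -> 'I_n), increasing f -> increasing g ->
  0 <= eps r * \det (mxsub f g A).

Lemma sign_pattern_increasing (R : realType) (eps : nat -> R) m n r
    (f : 'I_r -> 'I_m) (g : 'I_r -> 'I_n) :
  sign_pattern (minn m n) eps -> increasing f -> increasing g ->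
  eps r = 1 \/ eps r = -1.
Proof.
case=> eps0 epsP /increasing_leq hf /increasing_leq hg.
case: r hf hg {f g} => [|r] hf hg; first by left.
by apply: epsP; rewrite leq_min hf.
Qed.

Lemma sign_regularP (R : realType) (eps : nat -> R) m n (A : 'M[R]_(m, n)) :
  sign_pattern (minn m n) eps -> (sign_regular eps A <-> minors_sign eps A).
Proof.
move=> epsP; split=> [Asr r f g hf hg|Ams r f g _ hf hg d0].
  have [-> |d0] := eqVneq (\det (mxsub f g A)) 0; first by rewrite mulr0.
  case: r f g hf hg d0 => [|r] f g hf hg d0.
    by rewrite epsP.1 det_mx00 mul1r ler01.
  rewrite -(Asr _ _ _ _ hf hg d0) ?leq_min ?(increasing_leq hf) ?(increasing_leq hg) //.
  by rewrite -normrEsg normr_ge0.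
have := Ams _ _ _ hf hg.
case: (sign_pattern_increasing epsP hf hg) => ->; rewrite ?mul1r ?mulN1r ?oppr_ge0 => dge.
  by apply: gtr0_sg; rewrite lt0r d0.
by apply: ltr0_sg; rewrite lt_neqAle d0.
Qed.

(* P merges consecutive columns of A into blocks, b j being the block of j;
   this makes the column selections occurring in det (A P) increasing. *)
Lemma minors_sign_merge (R : realType) (eps : nat -> R) m n p
    (A : 'M[R]_(m, n)) (P : 'M[R]_(n, p)) (b : nat -> nat) :
  {homo b : i j / (i <= j)%N} -> (forall j k, 0 <= P j k) ->
  (forall j k, P j k != 0 -> b j = k) ->
  minors_sign eps A -> minors_sign eps (A *m P).
Proof.
move=> b_homo P_ge0 Pb Ams r f g hf hg.
have -> : mxsub f g (A *m P) = rowsub f A *m colsub g P.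
  by apply/matrixP => i j; rewrite !mxE; apply: eq_bigr => k _; rewrite !mxE.
rewrite det_mul_colsub mulr_sumr; apply: sumr_ge0 => h _; rewrite mulrCA.
have [->|] := eqVneq (\prod_i colsub g P (h i) i) 0; first by rewrite mul0r.
move=> /prodf_neq0 hP.
apply: mulr_ge0; first by apply: prodr_ge0 => i _; rewrite mxE.
have -> : colsub h (rowsub f A) = mxsub f h A.
  by apply/matrixP => i j; rewrite !mxE.
apply: Ams => // i j /hg; apply: contraTT; rewrite -!leqNgt => /b_homo.
have bh k : b (h k) = g k by apply: Pb; have := hP k isT; rewrite mxE.
by rewrite !bh.
Qed.

Lemma adj_mul_first_ge0 (R : realType) (e s : R) q (D : 'M[R]_q.+1)
    (v : 'cV[R]_q.+1) :
  (forall i, 0 <= e * \det (mxsub (lift i) (lift ord0) D)) ->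
  (forall i : 'I_q.+1, 0 < s * (-1) ^+ i * v i 0) ->
  0 <= e * s * (\adj D *m v) ord0 0.
Proof.
move=> De vs; rewrite adj_mul_first mulr_sumr; apply: sumr_ge0 => i _.
rewrite [leRHS](_ : _ = s * (-1) ^+ i * v i 0 *
  (e * \det (mxsub (lift i) (lift ord0) D))); last by ring.
by rewrite mulr_ge0 // ltW.
Qed.

Lemma sgr_eq_sign (R : realType) (e s t : R) :
  e = 1 \/ e = -1 -> 0 < e * s * t -> Num.sg s = e * Num.sg t.
Proof.
move=> he; rewrite -sgr_gt0 !sgrM.
case: he => ->; rewrite ?sgrN1 ?sgr1; case: sgrP => _; case: sgrP => _;
  rewrite ?(mul1r, mulN1r, mulr0, mulr1, mulrN1, opprK, oppr0, oppr_gt0, ltxx, ltr10) //;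
  rewrite ?ltrN10 //.
Qed.

(** The q + 1 alternating rows are independent, hence at most p + 1. If q = p they form an
    invertible D whose determinant has sign [eps p.+1], and (det D) z_0 is the first entry of adj(D)
    D z, which has the sign of [eps p * s]. *)
Lemma minors_sign_alternates (R : realType) (eps : nat -> R) m p
    (B : 'M[R]_(m, p.+1)) (z : 'cV[R]_p.+1) q (s t : R) :
  sign_pattern (minn m p.+1) eps -> minors_sign eps B ->
  (forall k : 'I_p.+1, z k 0 = t * (-1) ^+ k) -> alternates q s (B *m z) ->
  (q <= p)%N /\ (q = p -> Num.sg s = eps p * eps p.+1 * Num.sg t).
Proof.
move=> epsP Bms zE [f hf Bz].
have Dz (i : 'I_q.+1) : 0 < s * (-1) ^+ i * (rowsub f B *m z) i 0.
  by rewrite mul_rowsub_mx mxE.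
have Dfree : row_free (rowsub f B).
  apply: (@row_free_alternating _ _ _ _ z s) => // r h h' g hh hh' hg.
  rewrite -!mxsub_comp /=.
  have [hfh hfh'] := (increasing_comp hf hh, increasing_comp hf hh').
  have := mulr_ge0 (Bms _ _ _ hfh hg) (Bms _ _ _ hfh' hg).
  case: (sign_pattern_increasing epsP hfh hg) => ->;
    by rewrite ?mul1r ?mulN1r ?mulrNN.
split.
  by have := rank_leq_col (rowsub f B); rewrite (eqP Dfree) ltnS.
move=> qp; subst q.
have hid k : increasing (@id 'I_k) by [].
have D0 : \det (rowsub f B) != 0.
  by rewrite -unitfE -unitmxE -row_free_unit.
have De : 0 < eps p.+1 * \det (rowsub f B).
  rewrite lt0r Bms // andbT mulf_neq0 //.
  by case: (sign_pattern_increasing epsP hf (hid _)) => ->; rewrite ?oppr_eq0 oner_eq0.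
have := @adj_mul_first_ge0 _ (eps p) s _ (rowsub f B) _ _ Dz.
rewrite mulmxA mul_adj_mx mul_scalar_mx mxE zE mulr1 => adj_ge0.
have {}adj_ge0 : 0 <= eps p * s * (\det (rowsub f B) * t).
  apply: adj_ge0 => i; rewrite -mxsub_comp /=.
  by apply: Bms; first apply: increasing_comp => //; apply: increasing_lift.
have s0 : s != 0 by apply: contraTneq (Dz ord0) => ->; rewrite !mul0r ltxx.
have t0 : t != 0.
  apply: contraTneq (Dz ord0) => t0.
  rewrite (_ : z = 0) ?mulmx0 ?mxE ?mulr0 ?ltxx //.
  by apply/colP => k; rewrite zE t0 mul0r mxE.
have ep : eps p = 1 \/ eps p = -1.
  apply: (@sign_pattern_increasing _ _ _ _ _ (f \o lift ord0) (lift ord0) epsP).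
    by apply: increasing_comp => //; apply: increasing_lift.
  exact: increasing_lift.
have epS := sign_pattern_increasing epsP hf (hid _).
apply: sgr_eq_sign.
  by case: ep => ->; case: epS => ->; rewrite ?mulrNN ?mul1r ?mulr1; tauto.
have {}adj_gt0 : 0 < eps p * s * (\det (rowsub f B) * t).
  rewrite lt0r adj_ge0 andbT !mulf_neq0 //.
  by case: ep => ->; rewrite ?oppr_eq0 oner_eq0.
(* Multiplying by the positive [eps p.+1 * \det (rowsub f B)] produces the square of the
   determinant, which can be divided out. *)
rewrite -(pmulr_lgt0 _ (_ : 0 < \det (rowsub f B) ^+ 2)) ?exprn_even_gt0 //.
have := mulr_gt0 adj_gt0 De; congr (_ < _); ring.
Qed.

(** * Variation diminution from the signs of minors *)

Lemma sign_changes0 (R : realType) n : sign_changes (0 : 'cV[R]_n) = 0%N.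
Proof.
rewrite /sign_changes /nonzero_entries (_ : [seq a <- _ | _] = [::]) //.
by rewrite filter_map (eq_filter (a2 := pred0)) ?filter_pred0 // => i /=; rewrite mxE eqxx.
Qed.

Lemma minors_sign_variation (R : realType) (eps : nat -> R) m n
    (A : 'M[R]_(m, n)) :
  sign_pattern (minn m n) eps -> minors_sign eps A ->
  forall x : 'cV[R]_n, variation_diminishing_at eps A x.
Proof.
move=> epsP Ams x; rewrite /variation_diminishing_at.
have [->|Ax0] := eqVneq (A *m x) 0; first by rewrite sign_changes0.
have x0 : x != 0 by apply: contraNneq Ax0 => ->; rewrite mulmx0.
have xp : (sign_changes x < n)%N.
  by have [f /increasing_leq] := alternates_first x0.
(* Column [k] of [P] carries the absolute values of block [k], and [z] carries the signs of the
   blocks. *)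
pose P : 'M[R]_(n, (sign_changes x).+1) := \matrix_(j, k) (`|x j 0| *+ (block x j == k)).
pose z : 'cV[R]_(sign_changes x).+1 := \col_k (Num.sg (first_nonzero x) * (-1) ^+ k).
have PzE : P *m z = x.
  apply/colP => j; rewrite mxE.
  have hj : (block x j < (sign_changes x).+1)%N by rewrite ltnS block_sign_changes.
  rewrite (bigD1 (Ordinal hj)) //= big1 ?addr0 => [|k kj].
    rewrite !mxE eqxx mulr1n; have [->|xj0] := eqVneq (x j 0) 0.
      by rewrite normr0 mul0r.
    by rewrite [_ * (-1) ^+ _]mulrC -sgr_block // mulrC -numEsg.
  by rewrite !mxE eq_sym -[k == _ :> nat]/(k == Ordinal hj) (negbTE kj) mul0r.
have Bms : minors_sign eps (A *m P).
  apply: (@minors_sign_merge _ _ _ _ _ _ _ (block x)) => // [i j|j k|j k].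
  - exact: block_le.
  - by rewrite mxE mulrn_wge0.
  - by rewrite mxE; case: (block x j =P k) => // _; rewrite mulr0n eqxx.
have epsP' : sign_pattern (minn m (sign_changes x).+1) eps.
  split=> [|r hr]; first exact: epsP.1.
  by apply: epsP.2; rewrite !leq_min in hr *; lia.
have alt : alternates (sign_changes (A *m x)) (Num.sg (first_nonzero (A *m x)))
    (A *m P *m z) by rewrite -mulmxA PzE; apply: alternates_first.
have zE (k : 'I_(sign_changes x).+1) : z k 0 = Num.sg (first_nonzero x) * (-1) ^+ k by rewrite mxE.
have [le_xp eq_xp] := minors_sign_alternates epsP' Bms zE alt.
split=> // r _ Sw Sx _.
have first_eq : Num.sg (first_nonzero (A *m x)) =
    eps r * eps r.+1 * Num.sg (first_nonzero x).
  by rewrite -[LHS]sgr_id eq_xp ?Sx ?sgr_id.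
by split=> //; rewrite !sgr_last_nonzero Sw Sx first_eq mulrCA.
Qed.

(** * Passage to submatrices *)

(** Padding [y] with zeros outside the columns [g] changes neither its number of sign changes nor
    its first sign, and keeping only the rows [f] cannot add sign changes. *)
Lemma submatrix_variation (R : realType) (eps : nat -> R) m n k
    (A : 'M[R]_(m, n)) (f : 'I_k -> 'I_m) (g : 'I_k -> 'I_n) (y : 'cV[R]_k) :
  (1 <= k <= minn m n)%N -> increasing f -> increasing g ->
  (forall x : 'cV[R]_n, variation_diminishing_at eps A x) ->
  variation_diminishing_at eps (mxsub f g A) y.
Proof.
move=> hk hf hg Avd.
rewrite /variation_diminishing_at.
have [->|Ay0] := eqVneq (mxsub f g A *m y) 0; first by rewrite sign_changes0.
have y0 : y != 0 by apply: contraNneq Ay0 => ->; rewrite mulmx0.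
pose x := colsub g 1%:M *m y.
have xg i : x (g i) 0 = y i 0.
  rewrite mxE (bigD1 i) //= big1 => [|j ji].
    by rewrite !mxE eqxx mul1r addr0.
  by rewrite !mxE (inj_eq (increasing_inj hg)) eq_sym (negbTE ji) mul0r.
have xN0 j : x j 0 != 0 -> exists i, j = g i.
  move=> xj0; suff /existsP[i /eqP ji] : [exists i, j == g i] by exists i.
  apply: contraNT xj0.
  rewrite negb_exists => /forallP jg; rewrite mxE big1 // => i _.
  by rewrite !mxE (negbTE (jg i)) mul0r.
have wE : mxsub f g A *m y = rowsub f (A *m x).
  by rewrite mulmxA mulmx_colsub mulmx1 -mul_rowsub_mx -mxsub_comp.
have alt_w : alternates (sign_changes (mxsub f g A *m y))
    (Num.sg (first_nonzero (mxsub f g A *m y))) (A *m x).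
  have [h hh Hh] := alternates_first Ay0.
  exists (f \o h); first exact: increasing_comp.
  by move=> i; have := Hh i; rewrite [X in _ * X](_ : _ = (A *m x) (f (h i)) 0) // wE mxE.
have x0 : x != 0.
  by apply: contraNneq y0 => x0; apply/eqP/colP => i; rewrite -xg x0 !mxE.
have alt_x : alternates (sign_changes y) (Num.sg (first_nonzero y)) x.
  have [h hh Hh] := alternates_first y0.
  exists (g \o h); first exact: increasing_comp.
  by move=> i; rewrite /= xg.
have alt_y : alternates (sign_changes x) (Num.sg (first_nonzero x)) y.
  have [h hh Hh] := alternates_first x0.
  (* Alternating entries of [x] are non-zero, so their indices lie in the image of [g]. *)
  have /fin_all_exists[h' hE] i : exists i', h i = g i'.
    by apply: xN0; apply: contraTneq (Hh i) => ->; rewrite mulr0 ltxx.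
  exists h' => [i j ij|i]; last by rewrite -xg -hE.
  have := hh _ _ ij; rewrite !hE; apply: contraTT; rewrite -!leqNgt.
  rewrite leq_eqVlt => /orP[/eqP/val_inj-> //|/hg/ltnW //].
have [le_wx eq_wx] := alternates_le alt_w.
have [le_yx eq_yx] := alternates_le alt_x.
have [le_xy _] := alternates_le alt_y.
have Sxy : sign_changes y = sign_changes x by apply/eqP; rewrite eqn_leq le_yx.
have [le_Ax eq_Ax] := Avd x.
split; first by rewrite Sxy (leq_trans le_wx).
move=> r _ Sw Sy hr.
(* The count for [A *m x] is squeezed between those of the submatrix image and of [y], both equal to
   [r]. *)
have SAx : sign_changes (A *m x) = r.
  by apply/eqP; rewrite eqn_leq -{2}Sw le_wx andbT -Sy Sxy.
have Ax0 : A *m x != 0.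
  by apply: contraNneq Ay0 => Ax0; rewrite wE Ax0; apply/eqP/matrixP => i j; rewrite !mxE.
have [|first_Ax _] := eq_Ax r Ax0 SAx (etrans (esym Sxy) Sy).
  by move: hr hk; rewrite minnn; lia.
have first_eq : Num.sg (first_nonzero (mxsub f g A *m y)) =
    eps r * eps r.+1 * Num.sg (first_nonzero y).
  rewrite -[LHS]sgr_id eq_wx ?Sw ?SAx // first_Ax -eq_yx //.
  by rewrite sgr_id.
by split=> //; rewrite !sgr_last_nonzero Sw Sy first_eq mulrCA.
Qed.

(** * Signs of minors from the test vectors *)

(** If det D is non-zero, D y = (det D) alpha has q sign changes, the maximum for q + 1 entries. So
    both counts are q, and the sign clause at r = q ties the sign of det D to that of the first
    entry of y, which the minors of order q determine. *)
Lemma variation_minor_sign (R : realType) (eps : nat -> R) q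
    (D : 'M[R]_q.+1) (a : 'I_q.+1 -> R) :
  (forall r, (r <= q.+1)%N -> eps r = 1 \/ eps r = -1) ->
  (forall j, 0 < a j) ->
  (forall i, 0 <= eps q * \det (mxsub (lift i) (lift ord0) D)) ->
  variation_diminishing_at eps D (test_vector D a) ->
  0 <= eps q.+1 * \det D.
Proof.
move=> epsP a_gt0 De; set y := test_vector D a => -[le_S eq_S].
have [->|D0] := eqVneq (\det D) 0; first by rewrite mulr0.
have DyE (i : 'I_q.+1) : (D *m y) i 0 = \det D * ((-1) ^+ i * a i).
  by rewrite mulmxA mul_mx_adj mul_scalar_mx !mxE.
have alt_a (i : 'I_q.+1) : 0 < 1 * (-1) ^+ i * alternating_vector a i 0.
  by rewrite mxE mul1r mulrA -expr2 sqrr_sign mul1r.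
have alt_Dy : alternates q (\det D) (D *m y).
  exists id => // i; rewrite DyE.
  rewrite [ltRHS](_ : _ = ((-1) ^+ i) ^+ 2 * (\det D ^+ 2 * a i)); last by ring.
  by rewrite sqrr_sign mul1r mulr_gt0 // exprn_even_gt0.
have [le_qS eq_qS] := alternates_le alt_Dy.
have Dy0 : D *m y != 0.
  apply: contraTneq (a_gt0 ord0) => Dy0; have := DyE ord0; rewrite Dy0 mxE => /esym/eqP.
  by rewrite mul1r mulf_eq0 (negbTE D0) => /eqP ->; rewrite ltxx.
have y0 : y != 0 by apply: contraNneq Dy0 => ->; rewrite mulmx0.
have alt_y := alternates_first y0.
have Sy : sign_changes y = q.
  case: (alt_y) => h /increasing_leq hy _; apply/eqP; rewrite eqn_leq.
  by rewrite -ltnS hy (leq_trans le_qS).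
have SDy : sign_changes (D *m y) = q by apply/eqP; rewrite eqn_leq le_qS (leq_trans le_S) ?Sy.
have [|first_eq _] := eq_S q Dy0 SDy Sy; first by rewrite minnn subn1 /=.
(* All q + 1 entries of [y] take part in the alternation, so its first non-zero entry has index
   0. *)
have y_first : 0 < Num.sg (first_nonzero y) * y ord0 0.
  move: alt_y; rewrite Sy => -[h hh /(_ ord0)].
  by rewrite (increasing_first hh) mulr1.
have := adj_mul_first_ge0 De alt_a; rewrite mulr1 -/(test_vector D a) -/y => ey.
have sgD : Num.sg (\det D) = eps q * eps q.+1 * Num.sg (first_nonzero y).
  by rewrite eq_qS.
rewrite [\det D]numEsg sgD.
have -> : Num.sg (first_nonzero y) = eps q.
  have [e|e] := epsP q (leqnSn q); rewrite e in ey *.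
    move: y_first; case: sgrP => // _; rewrite ?mul0r ?ltxx // mulN1r; lra.
  move: y_first; case: sgrP => // _; rewrite ?mul0r ?ltxx // mul1r; lra.
have [e|e] := epsP q (leqnSn q); have [e'|e'] := epsP q.+1 (leqnn _);
  by rewrite e e' !(mulNr, mulrN, mul1r, opprK) normr_ge0.
Qed.

Theorem theoremC (R : realType) (m n : nat) (hm : (1 <= m)%N) (hn : (1 <= n)%N)
    (A : 'M[R]_(m, n)) (eps : nat -> R)
    (heps : sign_pattern (minn m n) eps)
    (alpha : forall k : nat, ('I_k -> 'I_m) -> ('I_k -> 'I_n) -> 'I_k -> R)
    (halpha : forall (k : nat) (f : 'I_k -> 'I_m) (g : 'I_k -> 'I_n),
        (1 <= k <= minn m n)%N -> increasing f -> increasing g ->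
        forall j : 'I_k, 0 < alpha k f g j) :
  [<-> sign_regular eps A;
       forall x : 'cV[R]_n, variation_diminishing_at eps A x;
       forall (k : nat) (f : 'I_k -> 'I_m) (g : 'I_k -> 'I_n),
         (1 <= k <= minn m n)%N -> increasing f -> increasing g ->
         variation_diminishing_at eps (mxsub f g A)
           (test_vector (mxsub f g A) (alpha k f g))].
Proof.
tfae=> [Asr|Avd k f g hk hf hg|Avd].
- by apply: minors_sign_variation => //; apply/sign_regularP.
- exact: submatrix_variation.
(* The induction on the order starts from the empty minor, where 1 matches [eps 0]. *)
apply/(sign_regularP _ heps); elim=> [|q IHq] f g hf hg.
  by rewrite heps.1 det_mx00 mulr1 ler01.
have hq : (1 <= q.+1 <= minn m n)%N.
  by rewrite leq_min (increasing_leq hf) (increasing_leq hg).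
apply: (@variation_minor_sign _ _ _ _ (alpha q.+1 f g)).
- case=> [|r] hr; first by left; apply: heps.1.
  by apply: heps.2; rewrite (leq_trans hr) //; case/andP: hq.
- exact: halpha.
- move=> i; rewrite -mxsub_comp.
  by apply: IHq; apply: increasing_comp => //; apply: increasing_lift.
- exact: Avd.
Qed.
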